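(* Given an integer $m\ge2$, the function $\lfloor\sqrt[m]{n}\rfloor$ (for integer arguments $n\ge1$) can be represented by the arithmetic term $$\mathrm{HW}(M_m(n))/(2mn)-(n+1)^2-1,$$ i.e. $\lfloor\sqrt[m]{n}\rfloor$ equals this expression for every integer $n\ge1$, where $$\begin{aligned}M_m(n)={}&\mathcal C(n^2,2)+\mathcal A(x_1^2,2)+\mathcal A(-2nx_1,2)\\&+\mathcal A(2x_1x_2^m,2)+\mathcal A(x_2^{2m},2)+\mathcal A(-2nx_2^m,2),\end{aligned}$$ with $\mathcal C$ and $\mathcal A$ formed with the parameters $t=n+1$ and $w=2mn$.
   Context: $\mathrm{HW}(N)$ is the Hamming weight of $N$ (number of ones in its binary representation). $G_r(q,s)=\sum_{j=0}^{s}j^rq^j$ with $0^0=1$; for each fixed $r$ this has a closed form. Given parameters $t>1$, $w$ (depending on the arguments) and $k\ge1$: $$\mathcal C(\varepsilon,k)=(2^w-\varepsilon+1)\,\frac{2^{2wt^k}-1}{2^w+1},$$ and for a monomial $\mu=\alpha\, b_1^{\beta_1x_1}\cdots b_k^{\beta_kx_k}x_1^{\gamma_1}\cdots x_k^{\gamma_k}$ in the formal variables $x_1,\dots,x_k$ (with $\alpha$ an integer possibly negative, and absent exponential factors meaning $\beta_i=0$, absent powers meaning $\gamma_i=0$), $$\mathcal A(\mu,k)=-(2^w-1)\,\alpha\prod_{i=1}^kG_{\gamma_i}\!\left(2^{2wt^{i-1}}b_i^{\beta_i},\,t-1\right).$$ An arithmetic term is an expression built from natural-number constants and the variables by the operations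 $x+y$, $\max(x-y,0)$, $\lfloor x/y\rfloor$, $x^y$ (with $0^0=1$, $\lfloor x/0\rfloor=0$). Products, $\mathrm{HW}$ and $G_r$ (fixed $r$) are expressible by arithmetic terms and are used as abbreviations; formulas are written with ordinary subtraction and exact division for readability. Here $m$ is fixed beforehand, so there is one arithmetic term in $n$ for each $m$. *)

(* Defs.v *)
From mathcomp Require Import all_boot all_order all_algebra all_field.

Set Implicit Arguments.
Unset Strict Implicit.
Unset Printing Implicit Defensive.

Import Order.TTheory GRing.Theory Num.Theory.

Local Open Scope nat_scope.

(* On nat, x - y is truncated, x %/ 0 = 0 and 0 ^ 0 = 1, which are exactly the
   conventions for arithmetic terms. *)
Inductive aterm (k : nat) : Type :=
  | AConst of nat
  | AVar of 'I_k
  | AAdd of aterm k & aterm k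
  | AMonus of aterm k & aterm k
  | ADiv of aterm k & aterm k
  | APow of aterm k & aterm k.

Fixpoint aeval (k : nat) (v : 'I_k -> nat) (T : aterm k) : nat :=
  match T with
  | AConst c => c
  | AVar i => v i
  | AAdd T1 T2 => aeval v T1 + aeval v T2
  | AMonus T1 T2 => aeval v T1 - aeval v T2
  | ADiv T1 T2 => aeval v T1 %/ aeval v T2
  | APow T1 T2 => aeval v T1 ^ aeval v T2
  end.

(* The summand is the i-th binary digit of N; as N < 2 ^ N, no digit equal to 1
   has index N or more. *)
Definition HW (N : nat) : nat := \sum_(i < N) (N %/ 2 ^ i) %% 2.

Definition G (r q s : nat) : nat := \sum_(j < s.+1) j ^ r * q ^ j.

(* The formal monomial
     coef * \prod_i (base i) ^ (bexp i * x_i) * \prod_i x_i ^ (deg i). *)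
Record monomial (k : nat) := Monomial {
  coef : int;
  base : k.-tuple nat;
  bexp : k.-tuple nat;
  deg : k.-tuple nat
}.

Local Open Scope ring_scope.

(* The quotient in calC is exact. *)
Lemma calC_exact (t w k : nat) :
  ((2 ^+ w + 1 : int) %| (2 ^+ (2 * w * t ^ k) - 1 : int))%Z.
Proof.
rewrite (mulnC 2%N) exprM subrX1 exprM subr_sqr_1.
by rewrite dvdz_mulr // dvdz_mull.
Qed.

Definition calC (t w : nat) (eps : int) (k : nat) : int :=
  (2 ^+ w - eps + 1) * ((2 ^+ (2 * w * t ^ k) - 1) %/ (2 ^+ w + 1))%Z.

(* The indices i : 'I_k start at 0, so that the variable x_(i+1) comes with
   t ^ i. *)
Definition calA (t w k : nat) (mu : monomial k) : int :=
  - (2 ^+ w - 1) * coef mu *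
  (\prod_(i < k)
     G (tnth (deg mu) i)
       (2 ^ (2 * w * t ^ i) * tnth (base mu) i ^ tnth (bexp mu) i)
       t.-1)%N%:Z.

(* alpha * x_1 ^ g1 * x_2 ^ g2 *)
Definition mono2 (alpha : int) (g1 g2 : nat) : monomial 2 :=
  Monomial alpha [tuple 1; 1]%N [tuple 0; 0]%N [tuple g1; g2].

Definition M (m n : nat) : int :=
  let t := n.+1 in
  let w := (2 * m * n)%N in
  calC t w (n%:Z ^+ 2) 2
  + calA t w (mono2 1 2 0)
  + calA t w (mono2 (- (2 * n%:Z)) 1 0)
  + calA t w (mono2 2 1 m)
  + calA t w (mono2 1 0 (2 * m))
  + calA t w (mono2 (- (2 * n%:Z)) 0 m).

(* Subtraction and division are those of the rationals; the absolute value only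
   turns an integer into a natural number and is meaningful when 0 <= M m n. *)
Definition root_expr (m n : nat) : rat :=
  (HW `|M m n|%N)%:R / (2 * m * n)%N%:R - (n%:R + 1) ^+ 2 - 1.

(* Main.v *)
Require Import Defs.
From mathcomp Require Import all_boot all_order all_algebra all_field.
From mathcomp Require Import zify ring.

Import Order.TTheory GRing.Theory Num.Theory.

(** Put [t = n + 1], [w = 2 * m * n] and let [s] be the integer part of the
    [m]-th root of [n], that is [s ^ m <= n < (s + 1) ^ m].

    The value of [M].  The polynomial part of [M m n] and the constant [n ^ 2]
    add up to [f i j = (i + j ^ m - n) ^ 2], and [calC] spreads its first factor
    over a geometric progression.  So [M m n] is the number whose base
    [2 ^ (2 * w)] digit of index [i + t * j], for [i, j < t], is
    [(2 ^ w - 1) * (2 ^ w + 1 - f i j)] ([M_digits]).  A multiple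
    [(2 ^ w - 1) * c] with [0 < c <= 2 ^ w] has exactly [w] ones, because it is
    the concatenation of [c - 1] and of the [w]-bit complement of [c - 1]
    ([HW_mersenne_mul]); for [f i j = 0] the digit is [2 ^ (2 * w) - 1], with
    [2 * w] ones.  Hence [HW (M m n)] is [w * (t ^ 2 + z)], where [z] is the
    number of zeros of [f], and [z = s + 1] because each [j <= s] has exactly
    one partner [i = n - j ^ m] ([HW_M]).

    The arithmetic term.  A term for [s] comes from the power method.  Modulo
    [X ^ m - n] the powers of [1 + X + ... + X ^ (m - 1)] have nonnegative
    coefficients [c 0, ..., c (m - 1)], whose weighted versions
    [u i = c i * r ^ i], [r] the real [m]-th root of [n], evolve by a
    convolution on the cyclic group of order [m] with the positive weights
    [1, r, ..., r ^ (m - 1)].  Such a convolution makes the [u i] nearly equal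
    (Doeblin contraction, [walk_osc]), so that [c 0 / c 1] tends to [r]; after
    [m * (n + 1) ^ 2] steps the error is below 1 ([walk_ratio]).  Substituting
    a huge integer [B] for [X] makes the coefficients the base [B] digits of a
    single remainder ([walk_value], [low_digits]), which an arithmetic term can
    compute.  The quotient [c 0 %/ c 1] differs from [s] by at most one, and
    comparing two [m]-th powers with [n] corrects it ([aeval_root]). *)

Local Open Scope nat_scope.

(** * Hamming weight of concatenations *)

(** The weight of the [L] low bits. Unlike in [HW], the range does not depend on
    the number, which is what makes concatenation additive. *)
Definition low_weight (L N : nat) : nat := \sum_(i < L) (N %/ 2 ^ i) %% 2.

(** Any cut-off above the top bit gives the Hamming weight, so that weights of
    numbers of different sizes can be compared and added. *)
Lemma HW_low_weight (L N : nat) : N < 2 ^ L -> HW N = low_weight L N.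
Proof.
move=> ltNL.
have stable k : N < 2 ^ k -> forall d, low_weight (k + d) N = low_weight k N.
  move=> ltNk; elim=> [|d IHd]; first by rewrite addn0.
  rewrite addnS /low_weight big_ord_recr /= -/(low_weight _ _) IHd divn_small.
    by rewrite mod0n addn0.
  by rewrite (leq_trans ltNk) // leq_exp2l // leq_addr.
rewrite /HW -/(low_weight N N) -(stable _ (ltn_expl N (ltnSn 1)) L).
by rewrite addnC stable.
Qed.

Lemma low_weight_cat (a b x y : nat) :
  x < 2 ^ a ->
  low_weight (a + b) (x + 2 ^ a * y) = low_weight a x + low_weight b y.
Proof.
move=> ltxa; rewrite /low_weight big_split_ord /=; congr (_ + _).
  apply: eq_bigr => i _.
  have -> : 2 ^ a = 2 ^ (a - i).-1 * 2 * 2 ^ i.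
    by rewrite -expnSr prednK ?subn_gt0 // -expnD subnK // ltnW.
  by rewrite [_ * y]mulnAC [_ * 2 * y]mulnAC addnC divnMDl ?expn_gt0 // modnMDl.
apply: eq_bigr => i _.
by rewrite expnD divnMA addnC [_ * y]mulnC divnMDl ?expn_gt0 // (divn_small ltxa) addn0.
Qed.

Lemma HW_cat (a x y : nat) : x < 2 ^ a -> HW (x + 2 ^ a * y) = HW x + HW y.
Proof.
move=> ltxa; have ltyy := ltn_expl y (ltnSn 1).
rewrite (HW_low_weight (a + y)) ?low_weight_cat //.
  by rewrite (HW_low_weight a) // (HW_low_weight y).
rewrite expnD; apply: (@leq_trans (2 ^ a * y.+1)); first by rewrite mulnS ltn_add2r.
by rewrite leq_mul2l ltyy orbT.
Qed.

Lemma digits_lt (B k : nat) (d : nat -> nat) :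
  (forall i, i < k -> d i < B) -> \sum_(i < k) d i * B ^ i < B ^ k.
Proof.
elim: k => [|k IHk] ltdB; first by rewrite big_ord0 expn0.
have B_gt0 : 0 < B by apply: leq_ltn_trans (ltdB k _).
rewrite big_ord_recr /=; apply: (@leq_trans (B ^ k + d k * B ^ k)).
  by rewrite ltn_add2r IHk // => i ltik; apply: ltdB; apply: ltnW.
by rewrite -mulSn expnS leq_mul2r ltdB ?orbT.
Qed.

Lemma HW_digits (L k : nat) (d : nat -> nat) :
  (forall i, i < k -> d i < 2 ^ L) ->
  HW (\sum_(i < k) d i * (2 ^ L) ^ i) = \sum_(i < k) HW (d i).
Proof.
elim: k => [|k IHk] ltdL; first by rewrite !big_ord0 /HW big_ord0.
have ltdL' i : i < k -> d i < 2 ^ L by move=> ltik; apply: ltdL; apply: ltnW.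
rewrite !big_ord_recr /= mulnC -expnM HW_cat ?IHk //.
by rewrite expnM digits_lt.
Qed.

(** Subtraction from [2 ^ w - 1] never borrows: it flips each of the [w] bits. *)
Lemma low_weight_compl (w d : nat) :
  d < 2 ^ w -> low_weight w (2 ^ w - 1 - d) + low_weight w d = w.
Proof.
elim: w d => [|w IHw] d ltdw; first by rewrite /low_weight !big_ord0.
have ltyw : d %/ 2 < 2 ^ w by rewrite ltn_divLR // -expnSr.
have split_bit x b : b < 2 -> low_weight w.+1 (b + 2 ^ 1 * x) = b + low_weight w x.
  move=> ltb2; rewrite -(add1n w) low_weight_cat //.
  by rewrite /low_weight big_ord1 expn0 divn1 modn_small.
have defd : d = d %% 2 + 2 ^ 1 * (d %/ 2) by rewrite addnC mulnC -divn_eq.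
have ltb2 : d %% 2 < 2 by rewrite ltn_mod.
have -> : 2 ^ w.+1 - 1 - d = (1 - d %% 2) + 2 ^ 1 * (2 ^ w - 1 - d %/ 2).
  rewrite expnS; lia.
rewrite {3}defd !split_bit //; last by rewrite ltnS leq_subr.
have := IHw _ ltyw; lia.
Qed.

Lemma HW_mersenne (w : nat) : HW (2 ^ w - 1) = w.
Proof.
rewrite (HW_low_weight w); last by rewrite subn1 ltn_predL expn_gt0.
have low0 : low_weight w 0 = 0 by apply: big1 => i _; rewrite div0n.
by have := low_weight_compl w 0; rewrite expn_gt0 subn0 low0 addn0 => /(_ isT).
Qed.

(** As [(2 ^ w - 1) * c = 2 ^ w * (c - 1) + (2 ^ w - 1 - (c - 1))], the high half
    is [c - 1] and the low half its complement, so the weights add up to [w]. *)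
Lemma HW_mersenne_mul (w c : nat) :
  0 < c <= 2 ^ w -> HW ((2 ^ w - 1) * c) = w.
Proof.
case: c => // c /= ltcw.
have -> : (2 ^ w - 1) * c.+1 = (2 ^ w - 1 - c) + 2 ^ w * c.
  by move: ltcw; set b := 2 ^ w => ltcb; nia.
have ltw : 2 ^ w - 1 - c < 2 ^ w by lia.
by rewrite HW_cat // (HW_low_weight w) // (HW_low_weight w c) // low_weight_compl.
Qed.

(** The base [2 ^ (2 * w)] digit of [M] at a point where the squared deviation
    is [f]: its weight detects whether [f = 0]. *)
Definition digit (w f : nat) : nat := (2 ^ w - 1) * (2 ^ w + 1 - f).

Lemma digit_lt (w f : nat) : digit w f < 2 ^ (2 * w).
Proof.
rewrite /digit mul2n -addnn expnD.
have := expn_gt0 2 w; rewrite /=; set b := 2 ^ w => b0.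
apply: (@leq_ltn_trans ((b - 1) * (b + 1))); first by rewrite leq_mul2l leq_subr orbT.
nia.
Qed.

Lemma HW_digit (w f : nat) :
  f <= 2 ^ w -> HW (digit w f) = w + (f == 0) * w.
Proof.
move=> lefw; rewrite /digit; case: eqP => [->|/eqP f_neq0].
  rewrite subn0 mul1n addnn -mul2n -[RHS]HW_mersenne; congr HW.
  rewrite mul2n -addnn expnD; have := expn_gt0 2 w; rewrite /=; set b := 2 ^ w; nia.
by rewrite HW_mersenne_mul ?addn0 //; lia.
Qed.

Local Open Scope ring_scope.

(** * The digits of M *)

(** The absolute value is the distance of naturals, not a truncated difference. *)
Definition sqdist (m n i j : nat) : nat := (`|(i + j ^ m)%N - n|%N ^ 2)%N.

Lemma calA_mono2 (n w : nat) (alpha : int) (g1 g2 : nat) :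
  calA n.+1 w (mono2 alpha g1 g2) =
  \sum_(j < n.+1) \sum_(i < n.+1)
    - (2 ^+ w - 1) * alpha * (i%:R ^+ g1 * j%:R ^+ g2) *
    ((2 ^+ (2 * w)) ^+ i * ((2 ^+ (2 * w)) ^+ n.+1) ^+ j).
Proof.
rewrite /calA [X in X%:Z]big_ord_recl big_ord_recl big_ord0.
rewrite !(tnth_nth 0%N) /= /G expn0 expn1 !muln1.
rewrite -natz natrM !natr_sum mulr_suml mulr_sumr.
rewrite [RHS]exchange_big; apply: eq_bigr => i _.
rewrite !mulr_sumr; apply: eq_bigr => j _.
rewrite (expnM 2 (2 * w) n.+1) !natrM !natrX; ring.
Qed.

(** [2 ^ (2 * w) - 1] splits as [(2 ^ w + 1) * (2 ^ w - 1)], and the geometric sum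
    over all [t ^ 2] positions is the product of the sums over rows and columns. *)
Lemma calC_sum (n w : nat) (eps : int) :
  calC n.+1 w eps 2 =
  \sum_(j < n.+1) \sum_(i < n.+1)
    (2 ^+ w - eps + 1) * (2 ^+ w - 1) *
    ((2 ^+ (2 * w)) ^+ i * ((2 ^+ (2 * w)) ^+ n.+1) ^+ j).
Proof.
rewrite /calC; set q : int := 2 ^+ (2 * w).
have -> : (2 ^+ (2 * w * n.+1 ^ 2) - 1 : int) =
    (2 ^+ w - 1) * ((\sum_(i < n.+1) q ^+ i) * (\sum_(j < n.+1) (q ^+ n.+1) ^+ j))
    * (2 ^+ w + 1).
  rewrite exprM -/q -mulnn exprM subrX1 subrX1.
  have -> : q = 2 ^+ w * 2 ^+ w by rewrite -exprD addnn -mul2n.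
  ring.
rewrite mulzK; last by rewrite lt0r_neq0 // ltr_wpDl ?exprn_ge0.
rewrite mulrA [X in _ * X]mulrC mulr_suml mulr_sumr; apply: eq_bigr => j _.
by rewrite mulr_sumr mulr_sumr; apply: eq_bigr => i _; ring.
Qed.

(** This is what the choice [w = 2 * m * n] is for: [n <= 2 ^ n] gives
    [(n ^ m) ^ 2 <= 2 ^ w]. *)
Lemma sqdist_le (m n i j : nat) :
  (0 < m)%N -> (i <= n)%N -> (j <= n)%N -> (sqdist m n i j <= 2 ^ (2 * m * n))%N.
Proof.
move=> m_gt0 lein lejn.
have lejm : (j ^ m <= n ^ m)%N by rewrite leq_exp2r.
have lenm : (n <= n ^ m)%N.
  by have [->|n_gt0] := posnP n; rewrite // -{1}[n]expn1 leq_pexp2l.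
have -> : (2 ^ (2 * m * n) = ((2 ^ n) ^ m) ^ 2)%N by rewrite -!expnM; congr expn; ring.
apply: (@leq_trans ((n ^ m) ^ 2)); rewrite leq_exp2r //; first by lia.
by rewrite leq_exp2r // ltnW // ltn_expl.
Qed.

Lemma M_digits (m n : nat) :
  (0 < m)%N ->
  M m n =
  (\sum_(j < n.+1)
     (\sum_(i < n.+1)
        digit (2 * m * n) (sqdist m n i j) * (2 ^ (2 * (2 * m * n))) ^ i)
     * (2 ^ (2 * (2 * m * n) * n.+1)) ^ j)%N%:Z.
Proof.
move=> m_gt0; rewrite /M calC_sum !calA_mono2 -!big_split /=.
rewrite -[RHS]natz natr_sum; apply: eq_bigr => j _.
rewrite natrM natr_sum mulr_suml -!big_split; apply: eq_bigr => i _ /=.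
rewrite natrM !natrX (exprM _ _ n.+1).
have lefw : (sqdist m n i j <= 2 ^ (2 * m * n))%N.
  by apply: sqdist_le => //; rewrite -ltnS.
have -> : (digit (2 * m * n) (sqdist m n i j))%:R =
    (2 ^+ (2 * m * n) - 1) * (2 ^+ (2 * m * n) + 1
       - (i%:R + j%:R ^+ m - n%:R) ^+ 2) :> int.
  rewrite natrM !natrB ?expn_gt0 //; last by rewrite (leq_trans lefw) // leq_addr.
  rewrite natrD natrX /sqdist; congr (_ * (_ - _)).
  by rewrite natrX natz abszE real_normK ?num_real // -!natz natrD natrX.
have -> : (j%:R ^+ (2 * m) : int) = (j%:R ^+ m) ^+ 2 by rewrite -exprM mulnC.
by rewrite -![n%:Z]natz; ring.
Qed.

(** * Hamming weight of M *)

Lemma le_root (m n s j : nat) :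
  (0 < m)%N -> (s ^ m <= n < s.+1 ^ m)%N -> (j ^ m <= n)%N = (j <= s)%N.
Proof.
move=> m_gt0 /andP[les lts]; apply/idP/idP => [lejn | lejs].
  by rewrite -ltnS -(ltn_exp2r _ _ m_gt0) (leq_ltn_trans lejn lts).
by rewrite (leq_trans _ les) ?leq_exp2r.
Qed.

(** For given [j], the equation [i + j ^ m = n] has one solution if [j <= s] and
    none otherwise. *)
Lemma count_zeros (m n s : nat) :
  (0 < m)%N -> (s ^ m <= n < s.+1 ^ m)%N ->
  (\sum_(j < n.+1) \sum_(i < n.+1) (sqdist m n i j == 0) = s.+1)%N.
Proof.
move=> m_gt0 /andP[les lts].
have lesn : (s <= n)%N.
  by case: s les {lts} => // s; apply: leq_trans; rewrite -{1}[s.+1]expn1 leq_pexp2l.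
have inner j : (\sum_(i < n.+1) (sqdist m n i j == 0) = (j < s.+1))%N.
  rewrite ltnS -(le_root m n s) ?les //.
  have zeroE i : (sqdist m n i j == 0)%N = ((i + j ^ m)%N == n).
    rewrite /sqdist expn_eq0 andbT; lia.
  case: leqP => [lejn | ltnj].
    have ltd : (n - j ^ m < n.+1)%N by rewrite ltnS leq_subr.
    rewrite (bigD1 (Ordinal ltd)) //= big1 ?addn0 => [|i].
      by rewrite zeroE subnK // eqxx.
    rewrite zeroE -val_eqE /= => neq; apply/eqP; rewrite eqb0.
    by apply: contra neq => /eqP {2}<-; rewrite addnK.
  rewrite big1 // => i _; rewrite zeroE; case: eqP => // defn.
  by move: ltnj; rewrite -defn ltnNge leq_addl.
under eq_bigr => j _ do rewrite inner.
rewrite -(big_mkord predT (fun j => (j < s.+1) : nat)) (big_cat_nat (n := s.+1)) //=.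
rewrite [X in (X + _)%N]big_nat (eq_bigr (fun=> 1%N)) => [|j /= ->] //.
rewrite -big_nat sum_nat_const_nat subn0 muln1 big_nat big1 ?addn0 //.
by move=> j /andP[lesj _]; rewrite ltnNge lesj.
Qed.

(** All [t ^ 2] digits contribute [w], and each of the [s + 1] zeros contributes
    [w] more. *)
Lemma HW_M (m n s : nat) :
  (0 < m)%N -> (s ^ m <= n < s.+1 ^ m)%N ->
  HW `|M m n|%N = (2 * m * n * (n.+1 ^ 2 + s.+1))%N.
Proof.
move=> m_gt0 root_s; rewrite M_digits // absz_nat.
set w := (2 * m * n)%N.
pose row j := (\sum_(i < n.+1) digit w (sqdist m n i j) * (2 ^ (2 * w)) ^ i)%N.
rewrite (HW_digits (2 * w * n.+1) n.+1 row) => [|j _]; last first.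
  rewrite expnM; apply: (@digits_lt _ _ (fun i => digit w (sqdist m n i j))) => i _.
  exact: digit_lt.
transitivity (\sum_(j < n.+1) \sum_(i < n.+1) (w + (sqdist m n i j == 0) * w))%N.
  apply: eq_bigr => j _; rewrite /row.
  rewrite (HW_digits _ _ (fun i => digit w (sqdist m n i j))) => [|i _];
    last exact: digit_lt.
  by apply: eq_bigr => i _; rewrite HW_digit // sqdist_le // -ltnS.
under eq_bigr => j _ do rewrite big_split /= sum_nat_const card_ord -big_distrl /=.
rewrite big_split /= sum_nat_const card_ord -big_distrl /= (count_zeros _ _ s) //; ring.
Qed.

Lemma root_exprE (m n s : nat) :
  (0 < m)%N -> (0 < n)%N -> (s ^ m <= n < s.+1 ^ m)%N -> root_expr m n = s%:R.
Proof.
move=> m_gt0 n_gt0 root_s; rewrite /root_expr (HW_M _ _ s) //.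
have w_neq0 : ((2 * m * n)%N%:R : rat) != 0 by rewrite pnatr_eq0 -lt0n !muln_gt0 m_gt0.
by rewrite natrM [X in X / _]mulrC mulfK // natrD natrX -!natr1; ring.
Qed.

(** * Power method modulo X ^ m - n *)

Section Walk.
Variables (d n : nat).
Notation m := d.+1.

(** [walk k] lists the coefficients of [(1 + X + ... + X ^ d) ^ k] modulo
    [X ^ (d + 1) - n]: the difference of indices is taken in the cyclic group, and
    a factor [n] replaces [X ^ (d + 1)] whenever the exponents wrap around. *)
Fixpoint walk (k : nat) (i : 'I_m) : nat :=
  if k is k'.+1 then (\sum_(l < m) (if l <= i then 1 else n) * walk k' (i - l)%R)%N
  else (i == ord0 : nat).

Lemma walkS (k : nat) (i : 'I_m) :
  walk k.+1 i = (\sum_(l < m) (if l <= i then 1 else n) * walk k (i - l)%R)%N.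
Proof. by []. Qed.

Lemma exp_wrap (R : comNzRingType) (x : R) (i l : 'I_m) :
  x ^+ l * x ^+ (i - l)%R = x ^+ i * (if (l <= i)%N then 1 else x ^+ m).
Proof.
rewrite -exprD; have ltim := ltn_ord i; have ltlm := ltn_ord l.
case: ifP => leli; rewrite ?mulr1 -?exprD; congr (_ ^+ _); rewrite /= modnDmr.
  by rewrite (_ : i + (m - l) = i - l + m)%N ?modnDr ?modn_small; lia.
by rewrite modn_small; lia.
Qed.

Definition geom (R : comNzRingType) (x : R) : R := \sum_(l < m) x ^+ l.

(** The congruence in the form of an equation with an explicit multiple of
    [x ^ m - n]: at [x] the root of [n] the multiple vanishes, at a large
    integer it gives a division with remainder. *)
Lemma walk_modulo (R : comNzRingType) (x : R) (k : nat) :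
  exists e, \sum_(i < m) (walk k i)%:R * x ^+ i = geom R x ^+ k - (x ^+ m - n%:R) * e.
Proof.
elim: k => [|k [e IHk]].
  exists 0; rewrite mulr0 subr0 expr0 (bigD1 ord0) //= big1 ?addr0 ?expr0 ?mulr1 //.
  by move=> i /negPf->; rewrite mul0r.
(* the coefficient of x ^ m * x ^ i in the unreduced product *)
pose wrap (i : 'I_m) := \sum_(l < m | (i < l)%N) (walk k (i - l)%R)%:R : R.
exists (geom R x * e + \sum_(i < m) x ^+ i * wrap i).
have step : \sum_(i < m) (walk k.+1 i)%:R * x ^+ i =
    geom R x * (\sum_(i < m) (walk k i)%:R * x ^+ i)
    - (x ^+ m - n%:R) * \sum_(i < m) x ^+ i * wrap i.
  have -> : geom R x * (\sum_(i < m) (walk k i)%:R * x ^+ i) =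
     \sum_(i < m) \sum_(l < m)
       x ^+ i * (if (l <= i)%N then 1 else x ^+ m) * (walk k (i - l)%R)%:R.
    rewrite exchange_big mulr_suml; apply: eq_bigr => l _ /=.
    rewrite mulr_sumr (reindex_inj (addIr (- l))) /=.
    by apply: eq_bigr => i _; rewrite -exp_wrap; ring.
  rewrite mulr_sumr -sumrB; apply: eq_bigr => i _.
  rewrite walkS natr_sum mulr_suml /wrap !mulr_sumr [X in _ - X]big_mkcond -sumrB.
  apply: eq_bigr => l _; rewrite natrM ltnNge; move: (walk k _) (x ^+ m) => a y.
  case: (l <= i)%N => /=; first by ring.
  by rewrite mulrBl opprB (mulrCA y) mulrA addrC subrK -mulrA [a%:R * _]mulrC.
by rewrite step IHk (exprS (geom R x)) mulrBr mulrDr opprD addrA (mulrCA (geom R x)).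
Qed.

Lemma walk_le (k : nat) (i : 'I_m) : (0 < n)%N -> (walk k i <= (m * n) ^ k)%N.
Proof.
move=> n_gt0; elim: k i => [|k IHk] i; first by rewrite expn0 leq_b1.
apply: (@leq_trans (\sum_(l < m) n * (m * n) ^ k)%N).
  by apply: leq_sum => l _; rewrite leq_mul //; case: ifP.
by rewrite sum_nat_const card_ord expnS mulnA.
Qed.

Section Contraction.
Variables (R : numFieldType) (r : R).
Hypotheses (r_ge1 : 1 <= r) (rm : r ^+ m = n%:R).
Let u k (i : 'I_m) := (walk k i)%:R * r ^+ i.
Let S := geom R r.

Lemma walk_total k : \sum_(i < m) u k i = S ^+ k.
Proof. by have [e ->] := walk_modulo R r k; rewrite rm subrr mul0r subr0. Qed.

Lemma walk_step k (i : 'I_m) : u k.+1 i = \sum_(l < m) r ^+ l * u k (i - l).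
Proof.
rewrite /u walkS natr_sum mulr_suml; apply: eq_bigr => l _.
rewrite natrM mulrCA exp_wrap; case: (l <= i)%N; rewrite ?rm; ring.
Qed.

Lemma geom_ge : m%:R <= S.
Proof.
rewrite -[m in m%:R]card_ord -sumr_const; apply: ler_sum => l _; exact: exprn_ege1.
Qed.

(** Every weight [r ^ l] is at least 1. Subtracting 1 from each weight leaves
    the differences of the [u] unchanged, as the total of [u] over the group is
    translation invariant; so one step multiplies the oscillation by at most
    [S - m], while it multiplies the total by [S]. *)
Lemma walk_osc k (i j : 'I_m) : `|u k i - u k j| <= (S - m%:R) ^+ k.
Proof.
elim: k i j => [|k IHk] i j.
  rewrite /u /= expr0; case: eqP => [->|_]; case: eqP => [->|_];
  by rewrite ?expr0 ?mul0r ?mulr1 ?subrr ?subr0 ?sub0r ?normrN ?normr0 ?normr1.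
have total a : \sum_(l < m) u k (a - l) = S ^+ k.
  by rewrite -walk_total [RHS](reindex_inj (subrI a)).
have -> : u k.+1 i - u k.+1 j =
    \sum_(l < m) (r ^+ l - 1) * (u k (i - l) - u k (j - l)).
  have no_drift : \sum_(l < m) (u k (i - l) - u k (j - l)) = 0.
    by rewrite sumrB !total subrr.
  rewrite !walk_step -sumrB -[LHS]subr0 -[X in _ - X]no_drift -sumrB.
  by apply: eq_bigr => l _; ring.
apply: le_trans (ler_norm_sum _ _ _) _.
have defD : S - m%:R = \sum_(l < m) (r ^+ l - 1).
  by rewrite sumrB sumr_const card_ord.
rewrite exprS {1}defD mulr_suml.
apply: ler_sum => l _; have r1 : 0 <= r ^+ l - 1 by rewrite subr_ge0 exprn_ege1.
by rewrite normrM (ger0_norm r1) ler_wpM2l.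
Qed.

(** Bernoulli's inequality [(1 - x) ^ k * (1 + k * x) <= 1] at [x = m / S], cleared
    of denominators. *)
Lemma osc_bernoulli k : (S - m%:R) ^+ k * (S + k%:R * m%:R) <= S ^+ k.+1.
Proof.
have D_ge0 : 0 <= S - m%:R by rewrite subr_ge0 geom_ge.
elim: k => [|k IHk]; first by rewrite expr0 mul1r mul0r addr0.
apply: (@le_trans _ _ (S * ((S - m%:R) ^+ k * (S + k%:R * m%:R)))); last first.
  by rewrite [leRHS]exprS ler_wpM2l // (le_trans _ geom_ge).
rewrite exprS -[k.+1%:R]natr1 -subr_ge0.
have -> : S * ((S - m%:R) ^+ k * (S + k%:R * m%:R)) -
   (S - m%:R) * (S - m%:R) ^+ k * (S + (k%:R + 1) * m%:R) =
   (S - m%:R) ^+ k * (k.+1%:R * m%:R ^+ 2) by rewrite -[k.+1%:R]natr1; ring.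
by rewrite mulr_ge0 ?exprn_ge0 // mulr_ge0 // ?exprn_ge0.
Qed.

(** [k * m] absorbs the factor [m * (r + 1) * S], and the summand [S] of Bernoulli's
    inequality makes the result strict; when the bound on the oscillation is 0,
    strictness comes from [S ^ k] being positive instead. *)
Lemma osc_small k :
  (r + 1) * S <= k%:R -> (S - m%:R) ^+ k * (m%:R * (r + 1)) < S ^+ k.
Proof.
move=> le_k; have S_gt0 : 0 < S by apply: lt_le_trans geom_ge; rewrite ltr0n.
set E := (S - m%:R) ^+ k.
have : 0 <= E by rewrite exprn_ge0 // subr_ge0 geom_ge.
rewrite le0r => /orP[/eqP->|E_gt0]; first by rewrite mul0r exprn_gt0.
rewrite -(ltr_pM2r S_gt0) -exprSr; apply: lt_le_trans (osc_bernoulli k).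
rewrite -mulrA ltr_pM2l //; apply: (@le_lt_trans _ _ (k%:R * m%:R)).
  by rewrite -mulrA mulrC ler_wpM2r.
by rewrite ltrDr.
Qed.

(** With [E] the bound on the oscillation, each [u] is at least [S ^ k / m - E];
    hence [|u 0 - u 1| <= E] is smaller than [u 1 / r] as soon as
    [m * (r + 1) * E < S ^ k]. *)
Lemma walk_ratio k (i j : 'I_m) :
  i = 0%N :> nat -> j = 1%N :> nat -> (r + 1) * S <= k%:R ->
  `|(walk k i)%:R - r * (walk k j)%:R| < (walk k j)%:R :> R.
Proof.
move=> i0 j1 le_k; have r_gt0 : 0 < r by apply: lt_le_trans r_ge1.
have ui : u k i = (walk k i)%:R by rewrite /u i0 expr0 mulr1.
have uj : u k j = r * (walk k j)%:R by rewrite /u j1 expr1 mulrC.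
set E := (S - m%:R) ^+ k.
have E_lb : S ^+ k <= m%:R * (u k j + E).
  rewrite -walk_total -[m in m%:R]card_ord mulr_natl -sumr_const; apply: ler_sum => l _.
  rewrite -lerBlDl; apply: le_trans (walk_osc k l j).
  by rewrite real_ler_norm // rpredB // /u rpredM ?rpredX ?realn ?gtr0_real.
have := lt_le_trans (osc_small _ le_k) E_lb; rewrite -/E mulrCA ltr_pM2l ?ltr0n //.
rewrite mulrDr mulr1 ltrD2r uj mulrC ltr_pM2l // -ui -uj.
by apply: le_lt_trans; apply: walk_osc.
Qed.

End Contraction.
End Walk.

(** * Approximation of the root by a quotient of digits *)

Lemma rootC_ge_nat (m n s : nat) :
  (0 < m)%N -> (s%:R <= m.-root (n%:R : algC)) = (s ^ m <= n)%N.
Proof.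
move=> m_gt0; rewrite -(ler_pXn2r m_gt0) ?nnegrE ?rootC_ge0 ?ler0n //.
by rewrite rootCK // -natrX ler_nat.
Qed.

Lemma rootC_lt_nat (m n s : nat) :
  (0 < m)%N -> (m.-root (n%:R : algC) < s%:R) = (n < s ^ m)%N.
Proof.
move=> m_gt0; rewrite -(ltr_pXn2r m_gt0) ?nnegrE ?rootC_ge0 ?ler0n //.
by rewrite rootCK // -natrX ltr_nat.
Qed.

(** The hypothesis on [k] dominates [(r + 1) * S], since [r <= n] and each of the
    [d + 1] terms of [S] is at most [r ^ (d + 1) = n]. *)
Lemma walk_quotient (d n s k : nat) (i j : 'I_d.+1) :
  i = 0%N :> nat -> j = 1%N :> nat -> (0 < n)%N ->
  (s ^ d.+1 <= n < s.+1 ^ d.+1)%N -> (d.+1 * n.+1 ^ 2 <= k)%N ->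
  (s <= (walk d n k i %/ walk d n k j).+1)%N /\
  (walk d n k i %/ walk d n k j <= s.+1)%N.
Proof.
move=> i0 j1 n_gt0 /andP[les lts] lek.
pose r : algC := d.+1.-root n%:R.
have les_r : s%:R <= r by rewrite rootC_ge_nat.
have ltr_s : r < s.+1%:R by rewrite rootC_lt_nat.
have rm : r ^+ d.+1 = n%:R by rewrite rootCK.
have r_ge1 : 1 <= r by rewrite rootC_ge1 // ler1n.
have le_k : (r + 1) * geom d algC r <= k%:R.
  have geom_le : geom d algC r <= (d.+1 * n)%:R.
    rewrite natrM -[X in X%:R * _]card_ord mulr_natl -sumr_const.
    by apply: ler_sum => l _; rewrite -rm ler_weXn2l // ltnW.
  have r_le : r + 1 <= n.+1%:R by rewrite -natr1 lerD2r -rm ler_eXnr.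
  apply: (@le_trans _ _ (n.+1%:R * (d.+1 * n)%:R)); last first.
    rewrite -natrM ler_nat; apply: leq_trans lek; nia.
  apply: ler_pM => //; first by rewrite addr_ge0 // (le_trans _ r_ge1).
  by apply: le_trans (geom_ge d algC r r_ge1); rewrite ler0n.
have := walk_ratio d n algC r r_ge1 rm k i j i0 j1 le_k.
set a := walk d n k i; set b := walk d n k j => ltab.
have b_gt0 : (0 < b)%N by rewrite -(ltr0n algC); apply: le_lt_trans ltab.
have r_real : r \is Num.real by rewrite ger0_real // (le_trans _ r_ge1).
move: ltab; rewrite real_ltr_distl ?rpredB ?rpredM ?realn // => /andP[ltba ltab].
split.
  have : (s * b < a + b)%N.
    rewrite -(ltr_nat algC) natrM natrD -ltrBlDr.
    by apply: le_lt_trans ltba; rewrite lerD2r ler_wpM2r.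
  by move/ltnW; rewrite -add1n -divnMDl // leq_divRL // mul1n addnC.
rewrite -ltnS ltn_divLR // -(ltr_nat algC) natrM -natr1 mulrDl mul1r.
by apply: lt_trans ltab _; rewrite ltrD2r ltr_pM2r ?ltr0n.
Qed.

(** [B] leaves room for a digit [walk d n k 0 + n], so that the number with digits
    [walk] stays below [B ^ (d + 1) - n] and is the remainder itself. *)
Lemma walk_value (d n k B : nat) :
  (0 < n)%N -> ((d.+1 * n) ^ k + n < B)%N ->
  (((B ^ d.+1 - 1) %/ (B - 1)) ^ k %% (B ^ d.+1 - n) =
   \sum_(i < d.+1) walk d n k i * B ^ i)%N.
Proof.
move=> n_gt0 ltB; set V := (\sum_(i < d.+1) _)%N.
have B_gt1 : (1 < B)%N.
  by apply: leq_ltn_trans ltB; rewrite (leq_trans n_gt0) // leq_addl.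
have -> : ((B ^ d.+1 - 1) %/ (B - 1) = \sum_(i < d.+1) B ^ i)%N.
  by rewrite !subn1 predn_exp mulKn // -ltnS prednK // ltnW.
have ltV : (V + n < B ^ d.+1)%N.
  have -> : (V + n = \sum_(i < d.+1)
      (walk d n k (inord i) + (i == 0 :> nat) * n) * B ^ i)%N.
    under [RHS]eq_bigr => i _ do rewrite inord_val mulnDl.
    rewrite big_split /= [in RHS](addnC) big_ord_recl /= big1 ?muln1 ?mul1n ?addn0 //.
    by rewrite addnC.
  apply: (@digits_lt _ _ (fun i => walk d n k (inord i) + (i == 0 :> nat) * n)%N) => i _.
  by apply: leq_ltn_trans ltB; rewrite leq_add ?walk_le //; case: eqP; rewrite ?mul1n.
have [e] := walk_modulo d n int B%:Z k.
have -> : \sum_(i < d.+1) (walk d n k i)%:R * B%:Z ^+ i = V%:Z.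
  by rewrite -[RHS]natz natr_sum; apply: eq_bigr => i _; rewrite natrM natrX !natz.
have -> : geom d int B%:Z = (\sum_(i < d.+1) B ^ i)%N%:Z.
  by rewrite -[RHS]natz natr_sum; apply: eq_bigr => i _; rewrite natrX natz.
move=> defV; apply/eqP; rewrite -eqz_nat -modz_nat; apply/eqP.
have -> : (B ^ d.+1 - n)%N%:Z = B%:Z ^+ d.+1 - n%:R.
  rewrite -subzn; last by lia.
  by rewrite -[(B ^ _)%N%:Z]natz natrX !natz.
have -> : ((\sum_(i < d.+1) B ^ i) ^ k)%N%:Z = e * (B%:Z ^+ d.+1 - n%:R) + V%:Z.
  by rewrite defV -[LHS]natz natrX !natz; ring.
rewrite modzMDl modz_small //=.
by rewrite ltrBrDr -!natz -natrX -natrD ltr_nat.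
Qed.

Lemma low_digits (d B : nat) (c : 'I_d.+2 -> nat) (i j : 'I_d.+2) :
  i = 0%N :> nat -> j = 1%N :> nat -> (forall l, c l < B)%N ->
  let N := (\sum_(l < d.+2) c l * B ^ l)%N in
  (N %% B = c i)%N /\ ((N %/ B) %% B = c j)%N.
Proof.
move=> i0 j1 ltcB /=.
have -> : i = ord0 by apply: val_inj.
have -> : j = lift ord0 ord0 by apply: val_inj.
have B_gt0 : (0 < B)%N by apply: leq_ltn_trans (ltcB i).
rewrite !big_ord_recl expn0 muln1.
have -> : (\sum_(l < d) c (lift ord0 (lift ord0 l)) * B ^ lift ord0 (lift ord0 l)
   = (\sum_(l < d) c (lift ord0 (lift ord0 l)) * B ^ l) * B * B)%N.
  by rewrite !big_distrl; apply: eq_bigr => l _; rewrite /= /bump !expnS /=; ring.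
rewrite /= expn1 -mulnDl addnC modnMDl divnMDl // modn_small // divn_small // addn0.
by rewrite addnC modnMDl modn_small.
Qed.

(** * Terms for products, remainders and roots *)

Section Terms.
Variable k : nat.
Implicit Types x y : aterm k.

(** From [(x + y) ^ 2 - (x ^ 2 + y ^ 2) = 2 * x * y]. *)
Definition tmul x y : aterm k :=
  ADiv (AMonus (APow (AAdd x y) (AConst k 2))
               (AAdd (APow x (AConst k 2)) (APow y (AConst k 2)))) (AConst k 2).

Definition tmod x y : aterm k := AMonus x (tmul (ADiv x y) y).

Lemma aeval_mul v x y : aeval v (tmul x y) = (aeval v x * aeval v y)%N.
Proof. by rewrite /= sqrnD addKn mulKn. Qed.

Lemma aeval_mod v x y : aeval v (tmod x y) = (aeval v x %% aeval v y)%N.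
Proof.
have -> : aeval v (tmod x y) = (aeval v x - aeval v (tmul (ADiv x y) y))%N by [].
by rewrite aeval_mul /= {1}(divn_eq (aeval v x) (aeval v y)) addKn.
Qed.
End Terms.

Section RootTerm.
Variable m : nat.
Let var : aterm 1 := AVar ord0.
Let const (c : nat) : aterm 1 := AConst 1 c.

Definition steps_term : aterm 1 := tmul 1 (const m) (APow (AAdd var (const 1)) (const 2)).
Definition base_term : aterm 1 :=
  AAdd (AAdd (APow (tmul 1 (const m) var) steps_term) var) (const 1).
Definition walk_term : aterm 1 :=
  tmod 1
    (APow (ADiv (AMonus (APow base_term (const m)) (const 1))
                (AMonus base_term (const 1))) steps_term)
    (AMonus (APow base_term (const m)) var).
Definition approx_term : aterm 1 :=
  ADiv (tmod 1 walk_term base_term) (tmod 1 (ADiv walk_term base_term) base_term).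

(** The indicator of [x ^ m <= n]. *)
Definition below_term (x : aterm 1) : aterm 1 :=
  AMonus (const 1) (AMonus (APow x (const m)) var).

(** An approximation [s - 1], [s] or [s + 1] passes respectively two, one and no
    test among [q <= s] and [q + 1 <= s]; the final decrement is then exact. *)
Definition root_term : aterm 1 :=
  AMonus (AAdd (AAdd approx_term (below_term approx_term))
               (below_term (AAdd approx_term (const 1)))) (const 1).
End RootTerm.

(** * Value of the root term *)

Section Evaluation.
Variables (m n : nat).
Let v : 'I_1 -> nat := fun=> n.

(** [tmul] and [tmod] come first, so that rewriting treats them as operations
    instead of unfolding them. *)
Lemma aevalE :
  ((forall x y, aeval v (tmul 1 x y) = (aeval v x * aeval v y)%N) *
   (forall x y, aeval v (tmod 1 x y) = (aeval v x %% aeval v y)%N)) *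
  ((forall x y, aeval v (AAdd x y) = (aeval v x + aeval v y)%N) *
   (forall x y, aeval v (AMonus x y) = (aeval v x - aeval v y)%N) *
   (forall x y, aeval v (ADiv x y) = (aeval v x %/ aeval v y)%N) *
   (forall x y, aeval v (APow x y) = (aeval v x ^ aeval v y)%N) *
   (forall c, aeval v (AConst 1 c) = c) * (forall i, aeval v (AVar i) = n)).
Proof. by do !split => *; rewrite ?aeval_mul ?aeval_mod. Qed.

Lemma aeval_approx (s : nat) :
  (1 < m)%N -> (0 < n)%N -> (s ^ m <= n < s.+1 ^ m)%N ->
  (s <= (aeval v (approx_term m)).+1)%N /\ (aeval v (approx_term m) <= s.+1)%N.
Proof.
case: m => [|[|d]] // _ n_gt0 root_s.
pose K := (d.+2 * (n + 1) ^ 2)%N; pose B := ((d.+2 * n) ^ K + n + 1)%N.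
have walk_lt l : (walk d.+1 n K l < B)%N.
  by rewrite /B addn1 ltnS (leq_trans (walk_le _ _ _ _ n_gt0)) ?leq_addr.
have [digit0 digit1] :=
  low_digits d B (walk d.+1 n K) ord0 (lift ord0 ord0) erefl erefl walk_lt.
have -> : aeval v (approx_term d.+2) =
    (walk d.+1 n K ord0 %/ walk d.+1 n K (lift ord0 ord0))%N.
  by rewrite !aevalE -/K -/B walk_value // ?digit0 ?digit1 // /B addn1.
by apply: walk_quotient; rewrite // /K addn1.
Qed.

Lemma aeval_root (s : nat) :
  (1 < m)%N -> (0 < n)%N -> (s ^ m <= n < s.+1 ^ m)%N ->
  aeval v (root_term m) = s.
Proof.
move=> m_gt1 n_gt0 root_s; have m_gt0 := ltnW m_gt1.
have [le_sq le_qs] := aeval_approx s m_gt1 n_gt0 root_s.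
have below x : aeval v (below_term m x) = (aeval v x <= s)%N.
  rewrite !aevalE -(le_root _ _ _ _ m_gt0 root_s); lia.
have s_gt0 : (0 < s)%N by rewrite -(le_root _ _ _ _ m_gt0 root_s) exp1n.
have -> : aeval v (root_term m) =
    (aeval v (approx_term m) + aeval v (below_term m (approx_term m))
     + aeval v (below_term m (AAdd (approx_term m) (AConst 1 1))) - 1)%N by [].
have evS x : aeval v (AAdd x (AConst 1 1)) = (aeval v x + 1)%N by [].
rewrite !below evS.
by move: (aeval v (approx_term m)) le_sq le_qs => q; lia.
Qed.

End Evaluation.

(** * The root as a Hamming weight and as an arithmetic term *)

Theorem theorem8p3 (m : nat) (hm : (2 <= m)%N) :
  exists T : aterm 1, forall n : nat, (1 <= n)%N ->
    [/\ 0 <= M m n,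
        (Num.floor (m.-root (n%:R : algC)))%:~R = root_expr m n
      & root_expr m n = (aeval (fun _ => n) T)%:R].
Proof.
have m_gt0 := ltnW hm.
exists (root_term m) => n n_gt0.
have /truncn_itv root_itv : 0 <= m.-root (n%:R : algC) by rewrite rootC_ge0.
pose s := Num.truncn (m.-root (n%:R : algC)).
have root_s : (s ^ m <= n < s.+1 ^ m)%N.
  by rewrite -rootC_ge_nat // -rootC_lt_nat.
split; first by rewrite M_digits.
- rewrite (root_exprE m n s) // (floor_def (m := s%:Z)) //.
  by rewrite intrD -!pmulrn natr1.
- by rewrite (root_exprE m n s) // (aeval_root m n s).
Qed.
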